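(* Let $K_h\in\mathbb{C}^{n_h\times n_h}$ be the PWDG matrix, with $$H_h=\frac{K_h+K_h^*}{2},\qquad G_h=\frac{K_h^*-K_h}{2i},\qquad K_h=H_h-iG_h,$$ where $G_h=G_h^*$ is positive definite, and let $B\in\mathbb{C}^{n_h\times n_h}$ satisfy $B^*G_hB=I$. Let $$\widehat K_h:=B^*K_hB,\qquad S:=B^*H_hB.$$ Then $\widehat K_h=S-iI$ with $S=S^*$. Hence $\widehat K_h$ is normal, its singular values are (with a suitable numbering of the eigenvalues $\lambda_j(S)$) $$\sigma_j(\widehat K_h)=\sqrt{1+\lambda_j(S)^2},$$ and $\sigma_{\min}(\widehat K_h)\ge1$.
   Context: $K_h$ is the stiffness matrix of a plane-wave discontinuous Galerkin (PWDG) discretization of the Helmholtz equation in a fixed coefficient basis; the only property of $K_h$ used in the statement is the standing assumption that $G_h=(K_h^*-K_h)/(2i)$ is positive definite (it is the Gram matrix of the DG graph norm). $^*$ is the conjugate transpose, $\lambda_j(S)$ are the (real) eigenvalues of the Hermitian matrix $S$. *)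

(* Defs.v *)
From mathcomp Require Import all_boot all_order all_algebra.
From mathcomp Require Import complex.

Set Implicit Arguments.
Unset Strict Implicit.
Unset Printing Implicit Defensive.

Import Order.TTheory GRing.Theory Num.Theory.
Local Open Scope ring_scope.
Local Open Scope sesquilinear_scope.

Definition posdefmx (C : numClosedFieldType) (n : nat) (A : 'M[C]_n) : Prop :=
  A \is hermsymmx /\
  forall x : 'cV[C]_n, x != 0 -> 0 < (x^t* *m A *m x) 0 0.

Section Eigenvalues.
Variables (F : closedFieldType) (n : nat) (A : 'M[F]_n).

(* The roots of the characteristic polynomial, repeated according to their
   algebraic multiplicity, in an unspecified order. *)
Definition eigenvalue_seq : seq F :=
  sval (closed_field_poly_normal (char_poly A)).

Lemma char_poly_eigenvalue_seq :
  char_poly A = \prod_(a <- eigenvalue_seq) ('X - a%:P).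
Proof.
rewrite /eigenvalue_seq; case: closed_field_poly_normal => r /= ->.
by rewrite (monicP (char_poly_monic A)) scale1r.
Qed.

Lemma size_eigenvalue_seq : size eigenvalue_seq == n.
Proof.
have := size_char_poly A.
by rewrite char_poly_eigenvalue_seq size_prod_XsubC => -[->].
Qed.

Definition eigenvalues : n.-tuple F := Tuple size_eigenvalue_seq.

End Eigenvalues.

Section SingularValues.
Variables (R : rcfType) (n : nat) (A : 'M[R[i]]_n).

(* The square roots of the eigenvalues of A^* A, with multiplicity, in
   nonincreasing order. These eigenvalues are nonnegative reals, so taking the
   real part only moves them from R[i] to R. *)
Definition singular_values : n.-tuple R :=
  [tuple of sort >=%R
     [tuple of map (fun a : R[i] => Num.sqrt (complex.Re a))
        (eigenvalues (A^t* *m A))]].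

(* The default 0 is only reached when n = 0. *)
Definition sigma_min : R := last 0 singular_values.

End SingularValues.

(* Main.v *)
Require Import Defs.
From mathcomp Require Import all_boot all_order all_algebra.
From mathcomp Require Import complex reals.

(** The congruence by [B] turns the form [G] into the identity, so
    [B^* K B = B^* (H - i G) B = S - i I] with [S] Hermitian.  Since [S]
    commutes with the identity, [S - i I] is normal, and the cross terms of
    [(S - i I)^* (S - i I) = (S + i I) (S - i I)] cancel, which leaves
    [S^2 + I].  The spectral theorem gives [S = P^-1 D P] with [D] real
    diagonal; the same [P] then diagonalizes [S^2 + I], into [D^2 + I].  The
    roots of a characteristic polynomial are determined with multiplicity, so
    the diagonals of [D] and [D^2 + I] are the eigenvalues of [S] and of
    [Khat^* Khat] with multiplicities ([perm_eigenvalues_diag]).  Taking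
    square roots, the singular values are the [sqrt (1 + l^2)], and all of
    them are at least [1].

    As the singular values come in nonincreasing order, the suitable
    numbering of the eigenvalues of [S] is the one that sorts [sqrt (1 + l^2)]
    ([singular_values_subi]). *)

Set Implicit Arguments.
Unset Strict Implicit.
Unset Printing Implicit Defensive.

Import Order.TTheory GRing.Theory Num.Theory.
Local Open Scope ring_scope.
Local Open Scope sesquilinear_scope.

Lemma char_poly_similar (R : comUnitRingType) (n : nat) (P A : 'M[R]_n) :
  P \in unitmx -> char_poly (invmx P *m A *m P) = char_poly A.
Proof.
move=> Pu; rewrite /char_poly.
have PVP : map_mx polyC (invmx P) *m map_mx polyC P = 1%:M.
  by rewrite -map_mxM mulVmx // map_mx1.
have -> : char_poly_mx (invmx P *m A *m P) =
    map_mx polyC (invmx P) *m char_poly_mx A *m map_mx polyC P.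
  rewrite /char_poly_mx mulmxBr mulmxBl !map_mxM; congr (_ - _).
  by rewrite -scalemx1 -scalemxAr -scalemxAl mulmx1 PVP.
by rewrite !det_mulmx mulrAC -det_mulmx PVP det1 mul1r.
Qed.

Lemma sqrD1_diag (R : comUnitRingType) (n : nat) (P S : 'M[R]_n)
    (d : 'rV[R]_n) :
  P \in unitmx -> S = invmx P *m diag_mx d *m P ->
  S *m S + 1%:M = invmx P *m diag_mx (\row_j (1 + d 0 j ^+ 2)) *m P.
Proof.
move=> Pu SE; have PP : 1%:M = invmx P *m 1%:M *m P by rewrite mulmx1 mulVmx.
rewrite {}SE {1}PP !mulmxA mulmxK // -mulmxDl.
rewrite -(mulmxA _ (diag_mx _)) -mulmxDr mulmx_diag.
rewrite -diag_const_mx -linearD; congr (_ *m diag_mx _ *m _).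
by apply/rowP => j; rewrite !mxE addrC expr2.
Qed.

(** Both sides list, with multiplicity, the roots of one characteristic
    polynomial, and a product of monic linear factors over a field determines
    its factors up to order. *)
Lemma perm_eigenvalues_diag (F : closedFieldType) (n : nat)
    (P : 'M[F]_n) (d : 'rV[F]_n) :
  P \in unitmx ->
  perm_eq (eigenvalues (invmx P *m diag_mx d *m P)) (codom (d 0)).
Proof.
move=> Pu; apply: prod_XsubC_eq.
rewrite -char_poly_eigenvalue_seq char_poly_similar //.
rewrite char_poly_trig ?diag_mx_is_trig // big_map big_enum /=.
by apply: eq_bigr => j _; rewrite mxE eqxx.
Qed.

Section ConjugateTranspose.
Variable C : numClosedFieldType.

Lemma trmxCD m n (A B : 'M[C]_(m, n)) : (A + B)^t* = A^t* + B^t*.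
Proof. by rewrite linearD map_mxD. Qed.

Lemma trmxCZ m n (a : C) (A : 'M[C]_(m, n)) : (a *: A)^t* = a^* *: A^t*.
Proof. by rewrite linearZ map_mxZ. Qed.

Lemma trmxCM m n p (A : 'M[C]_(m, n)) (B : 'M[C]_(n, p)) :
  (A *m B)^t* = B^t* *m A^t*.
Proof. by rewrite trmx_mul map_mxM. Qed.

Lemma trmxC1 n : (1%:M : 'M[C]_n)^t* = 1%:M.
Proof. by rewrite trmx1 map_mx1. Qed.

Lemma hermsymmxP n (A : 'M[C]_n) : reflect (A^t* = A) (A \is hermsymmx).
Proof.
by rewrite is_hermitianmxE scale1r eq_sym; apply: eqP.
Qed.

Lemma hermsymmx_congr n (A B : 'M[C]_n) :
  A \is hermsymmx -> B^t* *m A *m B \is hermsymmx.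
Proof.
move=> /hermsymmxP Ah; apply/hermsymmxP.
by rewrite !trmxCM trmxCK Ah mulmxA.
Qed.

Lemma hermsymmx_half n (A : 'M[C]_n) : 2^-1 *: (A + A^t*) \is hermsymmx.
Proof.
apply/hermsymmxP.
by rewrite trmxCZ trmxCD trmxCK addrC fmorphV rmorph_nat.
Qed.

Lemma cartesian_decomposition n (A : 'M[C]_n) :
  A = 2^-1 *: (A + A^t*) - 'i *: ((2 * 'i)^-1 *: (A^t* - A)).
Proof.
rewrite scalerA invfM mulrCA divff ?neq0Ci // mulr1 -scalerBr.
rewrite opprB addrCA addrK -mulr2n -scaler_nat scalerA mulVf ?scale1r //.
by rewrite pnatr_eq0.
Qed.

Lemma trmxC_hermsymmx_subi n (S : 'M[C]_n) :
  S \is hermsymmx -> (S - 'i *: 1%:M)^t* = S + 'i *: 1%:M.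
Proof.
move=> /hermsymmxP Sh.
by rewrite -scaleNr trmxCD trmxCZ trmxC1 Sh rmorphN /= conjCi opprK.
Qed.

(** The cross terms cancel because [S] commutes with the identity and
    ['i] is purely imaginary. *)
Lemma gram_hermsymmx_subi n (S : 'M[C]_n) : S \is hermsymmx ->
  (S - 'i *: 1%:M)^t* *m (S - 'i *: 1%:M) = S *m S + 1%:M.
Proof.
move=> Sh; rewrite trmxC_hermsymmx_subi // mulmxDl !mulmxBr.
rewrite -!scalemxAl -!scalemxAr mul1mx !mulmx1 scalerA -expr2 sqrCi.
by rewrite scaleN1r opprK addrA subrK.
Qed.

Lemma normalmx_hermsymmx_subi n (S : 'M[C]_n) :
  S \is hermsymmx -> S - 'i *: 1%:M \is normalmx.
Proof.
move=> Sh; apply/normalmxP; rewrite trmxC_hermsymmx_subi //.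
rewrite mulmxDr !mulmxBl mulmxDl !mulmxBr.
by rewrite -!scalemxAl -!scalemxAr !mul1mx !mulmx1.
Qed.

Lemma congr_subi n (H G B : 'M[C]_n) : B^t* *m G *m B = 1%:M ->
  B^t* *m (H - 'i *: G) *m B = B^t* *m H *m B - 'i *: 1%:M.
Proof. by move=> <-; rewrite mulmxBr mulmxBl -scalemxAr -scalemxAl. Qed.

End ConjugateTranspose.

Section RealSpectrum.
Variables (R : rcfType) (n : nat) (S : 'M[R[i]]_n).
Hypothesis Sh : S \is hermsymmx.

Lemma hermsymmx_real_diag : exists (P : 'M[R[i]]_n) (l : 'rV[R]_n),
  P \in unitmx /\ S = invmx P *m diag_mx (map_mx (real_complex R) l) *m P.
Proof.
exists (spectralmx S), (map_mx (@complex.Re R) (spectral_diag S)).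
split; first exact: spectral_unit.
have -> : map_mx (real_complex R) (map_mx (@complex.Re R) (spectral_diag S)) =
    spectral_diag S.
  apply/rowP => j; rewrite !mxE RRe_real //.
  by apply/mxOverP/hermitian_spectral_diag_real.
exact/orthomx_spectralP/hermitian_normalmx.
Qed.

(** A single diagonalization of [S] serves both [S] and [S^2 + 1], so that
    the two spectra are listed by the same sequence [l]. *)
Lemma eigenvalues_sqrD1 : exists l : seq R,
  perm_eq [seq real_complex R x | x <- l] (eigenvalues S) /\
  perm_eq [seq real_complex R (1 + x ^+ 2) | x <- l]
          (eigenvalues (S *m S + 1%:M)).
Proof.
have [P [l [Pu SE]]] := hermsymmx_real_diag.
exists (codom (l 0)); split.
  rewrite perm_sym {1}SE.
  apply: (perm_trans (perm_eigenvalues_diag _ Pu)).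
  by rewrite -map_comp (eq_codom (fun j => mxE _ _ 0 j)).
rewrite (sqrD1_diag Pu SE).
have -> : \row_j (1 + map_mx (real_complex R) l 0 j ^+ 2) =
    \row_j real_complex R (1 + l 0 j ^+ 2).
  by apply/rowP => j; rewrite !mxE rmorphD rmorph1 rmorphXn.
rewrite perm_sym; apply: (perm_trans (perm_eigenvalues_diag _ Pu)).
by rewrite -map_comp (eq_codom (fun j => mxE _ _ 0 j)).
Qed.

(** Sorting the values [sqrt (1 + x^2)] amounts to mapping the function over
    a list already sorted along it.  That sorted list is the numbering of the
    eigenvalues, so that a single [lambda] matches every index [j]. *)
Lemma singular_values_subi : exists lambda : n.-tuple R,
  perm_eq [seq real_complex R x | x <- lambda] (eigenvalues S) /\
  forall j : 'I_n, tnth (singular_values (S - 'i *: 1%:M)) j =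
                   Num.sqrt (1 + tnth lambda j ^+ 2).
Proof.
have [l [lS lQ]] := eigenvalues_sqrD1.
pose f (x : R) := Num.sqrt (1 + x ^+ 2).
pose s := sort (relpre f >=%R) l.
have sz : size s == n.
  by rewrite size_sort -(size_map (real_complex R)) (perm_size lS) size_tuple.
exists (Tuple sz); split; first by rewrite -(permPr lS) perm_map // perm_sort.
have sv : singular_values (S - 'i *: 1%:M) = map f s :> seq R.
  rewrite /s -(sort_map (f := f)) /=.
  apply/(perm_sortP ge_total ge_trans ge_anti).
  rewrite gram_hermsymmx_subi // perm_sym.
  have := perm_map (fun a : R[i] => Num.sqrt (complex.Re a)) lQ.
  by rewrite -map_comp.
move=> j; rewrite (tnth_nth 0) sv (nth_map 0) ?(eqP sz) //.
by rewrite (tnth_nth 0).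
Qed.

End RealSpectrum.

Theorem proposition2p3 (R : realType) (n : nat) (n_gt0 : (0 < n)%N)
    (K B : 'M[R[i]]_n) :
  let H := 2^-1 *: (K + K^t*) in
  let G := (2 * 'i)^-1 *: (K^t* - K) in
  let Khat := B^t* *m K *m B in
  let S := B^t* *m H *m B in
  posdefmx G ->
  B^t* *m G *m B = 1%:M ->
  [/\ K = H - 'i *: G,
      Khat = S - 'i *: 1%:M /\ S \is hermsymmx,
      Khat \is normalmx,
      exists lambda : n.-tuple R,
        perm_eq [seq real_complex R l | l <- lambda] (eigenvalues S) /\
        forall j : 'I_n,
          tnth (singular_values Khat) j = Num.sqrt (1 + tnth lambda j ^+ 2)
    & 1 <= sigma_min Khat].
Proof.
move=> H G Khat S _ BGB.
have KE : K = H - 'i *: G by exact: cartesian_decomposition.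
have Sh : S \is hermsymmx by apply/hermsymmx_congr/hermsymmx_half.
have KhatE : Khat = S - 'i *: 1%:M.
  by rewrite -(congr_subi _ BGB) -KE.
have [lambda [lS sv]] := singular_values_subi Sh.
rewrite KhatE; split => //; first exact: normalmx_hermsymmx_subi.
  by exists lambda.
(* The smallest singular value is the last entry, at index [n.-1]. *)
have n1 : (n.-1 < n)%N by rewrite prednK.
rewrite /sigma_min -nth_last size_tuple -(tnth_nth 0 _ (Ordinal n1)) sv.
by rewrite -[leLHS]sqrtr1 ler_wsqrtr // lerDl sqr_ge0.
Qed.
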